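(* Let $(A,+,\cdot,\leq_A)$ be a positive information algebra and let $(L,\leq_L)$ be a join-semilattice, with $A$ and $L$ disjoint. Let $S=A\cup L$ be equipped with the order $\leq$ and the operations $+$ and $\cdot$ defined in the context. Then $(S,+,\cdot,\leq)$ is a positive information algebra.
   Context: All semirings are commutative: a semiring is a set with $+,\cdot$ such that $(S,+,0)$ is a commutative monoid, $(S,\cdot,1)$ is a commutative monoid with $1\neq 0$, multiplication distributes over addition, and $0\cdot s=0$ for all $s$. A semiring is zerosumfree if $a+b=0$ implies $a=b=0$, and entire if $ab=0$ implies $a=0$ or $b=0$; an information algebra is a semiring that is both zerosumfree and entire. A semiring is positive if it is equipped with a partial order $\leq$ such that $0$ is the least element, $x\leq y$ implies $x+z\leq y+z$, and $x\leq y$ with $z\geq 0$ implies $xz\leq yz$. A positive information algebra is a positive semiring that is an information algebra. Order on $S=A\cup L$: it restricts to $\leq_A$ on $A$ and to $\leq_L$ on $L$; $a\leq\ell$ for all $a\in A$, $\ell\in L$; and $\ell\leq a$ never holds for $\ell\in L$, $a\in A$. Operations on $S$: $x+y=x+_A y$ if $x,y\in A$, and $x+y=\sup\{x,y\}$ otherwise; $x\cdot y=x\cdot_A y$ if $x,y\in A\setminus\{0\}$, $x\cdot y=0$ if $x=0$ or $y=0$, and $x\cdot y=\sup\{x,y\}$ otherwise. Suprema are taken in $(S,\leq)$. *)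

(* Defs.v *)
From HB Require Import structures.
From mathcomp Require Import all_boot all_order all_algebra.
From mathcomp Require Import boolp classical_sets.

Set Implicit Arguments.
Unset Strict Implicit.
Unset Printing Implicit Defensive.

Import Order.TTheory GRing.Theory.
Local Open Scope ring_scope.

Definition zerosumfree (S : comNzSemiRingType) : Prop :=
  forall a b : S, a + b = 0 -> a = 0 /\ b = 0.

Definition entire (S : comNzSemiRingType) : Prop :=
  forall a b : S, a * b = 0 -> a = 0 \/ b = 0.

Definition information_algebra (S : comNzSemiRingType) : Prop :=
  zerosumfree S /\ entire S.

Definition partial_order (T : Type) (le : rel T) : Prop :=
  [/\ reflexive le, antisymmetric le & transitive le].

(* The order is an explicit relation: a structure joining [porderType] with
   semirings clashes with the join [porderZmodType] of the library, which
   demands opposites. *)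
Definition positive (S : comNzSemiRingType) (le : rel S) : Prop :=
  [/\ partial_order le,
      forall x, le 0 x,
      forall x y z, le x y -> le (x + z) (y + z)
    & forall x y z, le x y -> le 0 z -> le (x * z) (y * z)].

Definition positive_information_algebra (S : comNzSemiRingType) (le : rel S)
  : Prop := positive le /\ information_algebra S.

(* [c] ranges over the commutative semiring structures on the type [S] itself;
   the equations say that its operations are the given ones. *)
Definition is_positive_information_algebra (S : Type) (zero one : S)
    (add mul : S -> S -> S) (le : rel S) : Prop :=
  exists c : GRing.ComNzSemiRing.axioms_ S,
    let R : comNzSemiRingType := GRing.ComNzSemiRing.Pack c in
    [/\ (0 : R) = zero,
        (1 : R) = one,
        forall x y : R, x + y = add x y,
        forall x y : R, x * y = mul x y
      & @positive_information_algebra R le].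

Definition is_sup2 (T : Type) (le : rel T) (x y s : T) : Prop :=
  [/\ le x s, le y s & forall t, le x t -> le y t -> le s t].

(* Defaults to [x] when [x] and [y] have no supremum. *)
Definition sup2 (T : choiceType) (le : rel T) (x y : T) : T :=
  xget x [set s | is_sup2 le x y s].

Section Extension.
Context (A : comNzSemiRingType) (leA : rel A).
Context (d : Order.disp_t) (L : joinSemilatticeType d).

(* The sum type renders the union of two disjoint sets. *)
Definition ext : choiceType := (A + L)%type.

Definition ext_le : rel ext := fun x y =>
  match x, y with
  | inl a, inl b => leA a b
  | inr l, inr m => (l <= m)%O
  | inl _, inr _ => true
  | inr _, inl _ => false
  end.

Definition ext_zero : ext := inl 0.

Definition ext_one : ext := inl 1.

Definition ext_add (x y : ext) : ext :=
  match x, y with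
  | inl a, inl b => inl (a + b)
  | _, _ => sup2 ext_le x y
  end.

Definition ext_mul (x y : ext) : ext :=
  if (x == ext_zero) || (y == ext_zero) then ext_zero
  else match x, y with
       | inl a, inl b => inl (a * b)
       | _, _ => sup2 ext_le x y
       end.

End Extension.

(* Main.v *)
Require Import Defs.
From mathcomp Require Import all_boot all_order all_algebra.
From HB Require Import structures.
From mathcomp Require Import classical_sets.

(** In each law, once an argument lies in [L], nonzero arguments from [A] are
neutral for both operations and the law reduces to the semilattice laws of [L].
Whether an argument of [A] vanishes matters only for multiplication: entireness
gives associativity ([a b <> 0] in [(a b) l = a (b l)]), and zerosumfreeness
gives distributivity ([a + b <> 0] in [(a + b) l = a l + b l]). *)

Set Implicit Arguments.
Unset Strict Implicit.
Unset Printing Implicit Defensive.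

Import Order.TTheory GRing.Theory.
Local Open Scope ring_scope.

(** Antisymmetry makes a supremum unique, so [xget] can only choose [s] and its default never
    occurs. *)
Lemma sup2_eq (T : choiceType) (le : rel T) (x y s : T) :
  antisymmetric le -> is_sup2 le x y s -> sup2 le x y = s.
Proof.
move=> le_anti [xs ys s_min]; apply: xget_unique => // t [xt yt t_min].
by apply: le_anti; rewrite t_min // s_min.
Qed.

(** Reduces the existence of a packed structure to laws on the bare operations, which can then be
    checked by cases on the sum type. *)
Lemma is_positive_information_algebraP (T : choiceType) (zero one : T)
    (add mul : T -> T -> T) (le : rel T) :
  associative add -> commutative add -> left_id zero add ->
  associative mul -> commutative mul -> left_id one mul ->
  left_distributive mul add -> left_zero zero mul -> one != zero ->
  partial_order le -> (forall x, le zero x) ->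
  (forall x y z, le x y -> le (add x z) (add y z)) ->
  (forall x y z, le x y -> le zero z -> le (mul x z) (mul y z)) ->
  (forall x y, add x y = zero -> x = zero /\ y = zero) ->
  (forall x y, mul x y = zero -> x = zero \/ y = zero) ->
  is_positive_information_algebra zero one add mul le.
Proof.
(* HB only infers the structure of a carrier of the form [Choice.Pack _]. *)
case: T zero one add mul le => T cT zero one add mul le.
move=> addA addC add0 mulA mulC mul1 mulD mul0 one_neq0 *.
pose C := Choice.Pack cT.
pose nmod := GRing.isNmodule.Build C addA addC add0.
pose V : nmodType := HB.pack T cT nmod.
pose semi := GRing.Nmodule_isComNzSemiRing.Build V
  mulA mulC mul1 mulD mul0 one_neq0.
pose R : comNzSemiRingType := HB.pack T V semi.
by exists (GRing.ComNzSemiRing.class R).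
Qed.

Section Extension.
Context (A : comNzSemiRingType) (leA : rel A).
Context (d : Order.disp_t) (L : joinSemilatticeType d).
Hypothesis leA_po : partial_order leA.

Local Notation S := (ext A L).
Local Notation le := (@ext_le A leA d L).
Local Notation add := (@ext_add A leA d L).
Local Notation mul := (@ext_mul A leA d L).
Local Notation inA := (@inl A L).
Local Notation inL := (@inr A L).

Lemma ext_le_partial_order : partial_order le.
Proof.
have [leA_refl leA_anti leA_trans] := leA_po.
split=> [[a|l]|[a|l] [b|m]|[b|m] [a|l] [c|n]] //=.
- by move/leA_anti->.
- by move/le_anti->.
- exact: leA_trans.
- exact: le_trans.
Qed.

Lemma sup2_inl_inr a l : sup2 le (inA a) (inL l) = inL l.
Proof. by apply: sup2_eq; [case: ext_le_partial_order | split => //=]. Qed.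

Lemma sup2_inr_inl a l : sup2 le (inL l) (inA a) = inL l.
Proof. by apply: sup2_eq; [case: ext_le_partial_order | split => //=]. Qed.

Lemma sup2_inr l m : sup2 le (inL l) (inL m) = inL (l `|` m)%O.
Proof.
apply: sup2_eq; first by case: ext_le_partial_order.
(* No upper bound of [inL l] lies in [A], so only bounds from [L] compete. *)
split=> [||[//|n]] /=; rewrite ?leUl ?leUr // => ln mn.
by rewrite leUx ln.
Qed.

(** Eliminates [sup2]: all of [A] lies below all of [L], so a mixed supremum is the argument from
    [L]. *)
Lemma ext_addE (x y : S) : add x y =
  match x, y with
  | inl a, inl b => inA (a + b)
  | inl _, inr m => inL m
  | inr l, inl _ => inL l
  | inr l, inr m => inL (l `|` m)%O
  end.
Proof.
by case: x y => [a|l] [b|m] //=; rewrite ?sup2_inl_inr ?sup2_inr_inl ?sup2_inr.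
Qed.

Lemma ext_mulE (x y : S) : mul x y =
  match x, y with
  | inl a, inl b => inA (a * b)
  | inl a, inr m => if a == 0 then inA 0 else inL m
  | inr l, inl b => if b == 0 then inA 0 else inL l
  | inr l, inr m => inL (l `|` m)%O
  end.
Proof.
have inl_eq0 a : (inA a == ext_zero A L) = (a == 0) by [].
have inr_neq0 l : (inL l == ext_zero A L) = false by [].
case: x y => [a|l] [b|m]; rewrite /ext_mul ?inl_eq0 ?inr_neq0 /=.
(* For two arguments in [A] the zero test agrees with the product of [A], where 0 is absorbing. *)
- by have [->|_] := eqVneq a 0; have [->|_] := eqVneq b 0; rewrite ?mul0r ?mulr0.
- by rewrite orbF sup2_inl_inr.
- by rewrite sup2_inr_inl.
- exact: sup2_inr.
Qed.

End Extension.

#[local] Arguments ext_add : simpl never.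
#[local] Arguments ext_mul : simpl never.

Theorem theorem2p7 (A : comNzSemiRingType) (leA : rel A)
    (hA : positive_information_algebra leA)
    (d : Order.disp_t) (L : joinSemilatticeType d) :
  is_positive_information_algebra (ext_zero A L) (ext_one A L)
    (@ext_add A leA d L) (@ext_mul A leA d L) (@ext_le A leA d L).
Proof.
have [[leA_po le0A leA_add leA_mul] [zsf ent]] := hA.
have [leA_refl leA_anti _] := leA_po.
have addE := @ext_addE A leA d L leA_po.
have mulE := @ext_mulE A leA d L leA_po.
(* Entireness and, next, zerosumfreeness in boolean form, to decide the zero tests that [mulE] puts
   on products and sums. *)
have mul_eq0 (a b : A) : (a * b == 0) = (a == 0) || (b == 0).
  apply/eqP/orP => [/ent[]->|[]/eqP->]; rewrite ?eqxx ?mul0r ?mulr0 //; by [left|right].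
have add_eq0 (a b : A) : (a + b == 0) = (a == 0) && (b == 0).
  by apply/eqP/andP => [/zsf[-> ->]|[/eqP-> /eqP->]]; rewrite ?addr0.
(* Makes [ext_one] neutral on [L]: the zero test in its product with [inL l] fails. *)
have one_neq0 : (1 : A) == 0 = false := negbTE (oner_neq0 A).
apply: is_positive_information_algebraP.
- by move=> [a|l] [b|m] [c|n]; rewrite !addE /= ?addrA ?joinA.
- by move=> [a|l] [b|m]; rewrite !addE /= 1?addrC 1?joinC.
- by move=> [a|l]; rewrite addE /= ?add0r.
- move=> [a|l] [b|m] [c|n]; rewrite !mulE /= ?mulrA ?joinA //;
    rewrite ?mul_eq0; do 1?[case: (eqVneq a 0) => [a0|/negbTE a0]];
    do 1?[case: (eqVneq b 0) => [b0|/negbTE b0]];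
    do 1?[case: (eqVneq c 0) => [c0|/negbTE c0]];
    by rewrite ?a0 ?b0 ?c0 /= ?eqxx ?mulr0 ?mul0r ?joinA.
- by move=> [a|l] [b|m]; rewrite !mulE /= 1?mulrC 1?joinC.
- by move=> [a|l]; rewrite mulE /= ?mul1r ?one_neq0.
- move=> [a|l] [b|m] [c|n]; rewrite addE !mulE /= ?mulrDl ?addE //;
    rewrite ?add_eq0; do 1?[case: (eqVneq a 0) => [a0|/negbTE a0]];
    do 1?[case: (eqVneq b 0) => [b0|/negbTE b0]];
    do 1?[case: (eqVneq c 0) => [c0|/negbTE c0]];
    rewrite ?a0 ?b0 ?c0 /= ?addE ?addr0 ?add0r ?mulr0 ?joinxx //.
  (* What remains has the multiplier [n] and at least one summand in [L]; the right side joins [n]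
     twice, and idempotence absorbs the repetition. *)
  + by rewrite joinCA joinxx.
  + by rewrite -joinA joinxx.
  + by rewrite joinACA joinxx.
- by move=> [a|l]; rewrite mulE /= ?mul0r ?eqxx.
- exact: oner_neq0 A.
- exact: ext_le_partial_order.
- by case=> [a|l] /=.
- move=> [a|l] [b|m] [c|n]; rewrite !addE //=; first exact: leA_add.
  + by move=> _; exact: leUr.
  + by move=> lm; exact: leU2.
- move=> [a|l] [b|m] [c|n]; rewrite !mulE //=; first exact: leA_mul.
  (* The danger is a left side [inL n] against a right side 0, that is [a != 0] and [b = 0];
     leastness of 0 rules it out. *)
  + move=> ab _; case: (eqVneq b 0) ab => [-> a_le0|_ _].
      have -> : a = 0 by apply: leA_anti; rewrite a_le0 le0A.
      by rewrite eqxx; exact: le0A.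
    by case: ifP => //= _; exact: lexx.
  + by case: eqVneq => [->|] //= _ _; rewrite mulr0.
  + by move=> _ _; case: ifP => //= _; exact: leUr.
  + by case: ifP => //=.
  + by move=> lm _; exact: leU2.
- by move=> [a|l] [b|m]; rewrite addE //= => -[/zsf[-> ->]].
(* A product with a factor in [L] leaves [L] only when the other factor is the zero of [A]. *)
- move=> [a|l] [b|m]; rewrite mulE //=.
  + by move=> -[/ent[]->]; [left|right].
  + by case: eqVneq => // -> _; left.
  + by case: eqVneq => // -> _; right.
Qed.
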